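(* For every $n\ge 3$, the hypercube graph $Q_n$ satisfies $\operatorname{nim}(\mathrm{DNT}(Q_n))=0$.
   Context: $Q_n$ is the graph whose vertices are the binary strings of length $n$, two of them being adjacent exactly when they differ in a single digit. For a graph $G$ with vertex set $V$, a set $K\subseteq V$ is convex if it contains every vertex lying on any shortest path between two elements of $K$. The convex hull $[P]$ of $P\subseteq V$ is the smallest convex set containing $P$. The game $\mathrm{DNT}(G)$: positions are the sets $P\subseteq V$ with $[V\setminus P]=V$; the starting position is $\emptyset$; the options of $P$ are the sets $P\cup\{v\}$ with $v\in V\setminus P$ and $[V\setminus(P\cup\{v\})]=V$. The nim-value of a position is defined recursively by $\operatorname{nim}(p)=\operatorname{mex}\{\operatorname{nim}(q): q\text{ an option of }p\}$, where $\operatorname{mex}(A)$ is the smallest nonnegative integer not in $A$; the nim-value of a game is that of its starting position. *)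

(* Defs.v *)
From mathcomp Require Import all_boot.
From mathcomp Require Import boolp.

Set Implicit Arguments.
Unset Strict Implicit.
Unset Printing Implicit Defensive.

Section Convexity.
Variables (T : finType) (e : rel T).

(* As in [path.v], a walk from x is the sequence x :: p. *)
Definition walk (x y : T) (p : seq T) : Prop :=
  path e x p /\ last x p = y.

Definition shortest_path (x y : T) (p : seq T) : Prop :=
  walk x y p /\ forall q, walk x y q -> size p <= size q.

Definition convex (K : {set T}) : Prop :=
  forall x y p, x \in K -> y \in K -> shortest_path x y p ->
  forall z, z \in x :: p -> z \in K.

Definition hull (P : {set T}) : {set T} :=
  \bigcap_(K : {set T} | `[< convex K >] && (P \subset K)) K.

Lemma sub_hull (P : {set T}) : P \subset hull P.
Proof. by apply/bigcapsP => K /andP[]. Qed.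

Lemma hull_min (P K : {set T}) : convex K -> P \subset K -> hull P \subset K.
Proof. by move=> cK PK; apply: bigcap_inf; rewrite PK andbT; apply/asboolP. Qed.

Lemma convex_hull (P : {set T}) : convex (hull P).
Proof.
move=> x y p /bigcapP xP /bigcapP yP pP z zp; apply/bigcapP => K KP.
have /andP[/asboolP cK _] := KP.
exact: cK (xP _ KP) (yP _ KP) pP _ zp.
Qed.

End Convexity.

Lemma mex_subproof (A : seq nat) : exists k, k \notin A.
Proof.
exists (\max_(a <- A) a).+1; apply/negP => mA.
by have := @leq_bigmax_seq _ A xpredT id _ mA isT; rewrite ltnn.
Qed.

Definition mex (A : seq nat) : nat := ex_minn (mex_subproof A).

Section DNT.
Variables (T : finType) (e : rel T).

Definition DNT_position (P : {set T}) : bool := hull e (~: P) == [set: T].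

Definition DNT_options (P : {set T}) : {set {set T}} :=
  [set v |: P | v in ~: P & DNT_position (v |: P)].

Fixpoint nim_rec (k : nat) (P : {set T}) : nat :=
  if k is k'.+1 then mex [seq nim_rec k' Q | Q <- enum (DNT_options P)] else 0.

(* At most #|~: P| moves can follow P; [nimE] is the defining recursion. *)
Definition nim (P : {set T}) : nat := nim_rec #|~: P| P.

Lemma DNT_options_card (P Q : {set T}) : Q \in DNT_options P -> #|~: P| = #|~: Q|.+1.
Proof.
case/imsetP => v; rewrite inE in_setC => /andP[vP _] ->.
by rewrite setCU setIC -setDE (cardsD1 v (~: P)) in_setC vP.
Qed.

Lemma nimE (P : {set T}) : nim P = mex [seq nim Q | Q <- enum (DNT_options P)].
Proof.
rewrite {1}/nim; case E: #|~: P| => [|k] /=; last first.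
  congr mex; apply/eq_in_map => Q; rewrite mem_enum => /DNT_options_card.
  by rewrite E => -[->].
have -> : enum (DNT_options P) = [::].
  case O: (enum _) => [|Q s] //.
  have := mem_head Q s; rewrite -O mem_enum => /DNT_options_card.
  by rewrite E.
by rewrite /= /mex; case: ex_minnP => m _ /(_ 0 isT); rewrite leqn0 => /eqP.
Qed.

Lemma DNT_position0 : DNT_position set0.
Proof. by rewrite /DNT_position setC0 eqEsubset subsetT sub_hull. Qed.

Definition nim_DNT : nat := nim set0.

End DNT.

Definition cube_adj (n : nat) : rel (n.-tuple bool) :=
  fun u v => #|[set i : 'I_n | tnth u i != tnth v i]| == 1.

(* Main.v *)
Require Import Defs.
From mathcomp Require Import all_boot.
From mathcomp Require Import boolp.

(* A set of vertices of the cube has full hull iff it meets every facet, so the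
   positions of the game are the sets containing no facet.  The second player
   answers each move by the antipodal vertex: if this completed a facet, then,
   the earlier position being invariant under the antipode, the opponent's own
   move would already have completed the opposite facet. *)

Set Implicit Arguments.
Unset Strict Implicit.
Unset Printing Implicit Defensive.

Lemma mex_eq0 (A : seq nat) : (mex A == 0) = (0 \notin A).
Proof.
rewrite /mex; case: ex_minnP => m mA min_m.
by apply/eqP/idP => [<- // | /min_m]; rewrite leqn0 => /eqP.
Qed.

Lemma nim_eq0P (T : finType) (e : rel T) (P : {set T}) :
  reflect (forall Q, Q \in DNT_options e P -> nim e Q != 0) (nim e P == 0).
Proof.
rewrite nimE mex_eq0; apply: (iffP negP) => [no0 Q PQ | opt /mapP[Q]].
  apply/negP => /eqP Q0; apply: no0; apply/mapP.
  by exists Q; rewrite ?mem_enum ?Q0.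
by rewrite mem_enum => /opt /eqP Q0 /esym.
Qed.

(** Strong induction on the number of unplayed vertices. After the move [v], the reply [a v]
    restores the symmetry, so it reaches a position of value 0; hence no option of [P] has value
    0. *)
Lemma pairing_strategy (T : finType) (e : rel T) (a : T -> T) :
    involutive a -> (forall v, a v != v) ->
    (forall (P : {set T}) v, a @^-1: P = P -> DNT_position e (v |: P) ->
       DNT_position e (a v |: (v |: P))) ->
  forall P : {set T}, a @^-1: P = P -> nim e P = 0.
Proof.
move=> aK a_neq a_pos P.
have [k] := ubnP #|~: P|; elim: k P => // k IHk P; rewrite ltnS => Pk aP.
have aE x : (a x \in P) = (x \in P) by rewrite -{2}aP inE.
apply/eqP/nim_eq0P => Q /[dup] PQ /imsetP[v].
rewrite inE in_setC => /andP[vP pos_v] defQ.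
(* The reply is a new vertex: [a v] differs from [v], and it is not in [P] because [P] is symmetric
   and omits [v]. *)
have QR : a v |: Q \in DNT_options e Q.
  apply/imsetP; exists (a v) => //.
  by rewrite inE in_setC defQ in_setU1 negb_or a_neq aE vP a_pos.
apply/negP => /nim_eq0P /(_ _ QR); apply/negP; rewrite negbK; apply/eqP/IHk.
  by rewrite (leq_trans _ Pk) // (DNT_options_card PQ) (DNT_options_card QR) leqW.
by apply/setP => x; rewrite defQ !inE aE (inj_eq (inv_inj aK)) (inv_eq aK) orbCA.
Qed.

Section Cube.
Variable n : nat.
Implicit Types (u v w x y z : n.-tuple bool) (i j : 'I_n) (b : bool).

Let adj := @cube_adj n.

Definition hdist u v := #|[set i | tnth u i != tnth v i]|.

Definition flip i u : n.-tuple bool :=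
  [tuple (if j == i then ~~ tnth u j else tnth u j) | j < n].

Definition antipode u : n.-tuple bool := map_tuple negb u.

Lemma hdistE u v : hdist u v = \sum_i (tnth u i != tnth v i).
Proof.
rewrite /hdist -sum1_card big_mkcond /=.
by apply: eq_bigr => i _; rewrite inE; case: (_ != _).
Qed.

Lemma hdist_triangle v u w : hdist u w <= hdist u v + hdist v w.
Proof.
rewrite !hdistE -big_split leq_sum // => i _.
by case: (tnth u i) (tnth v i) (tnth w i) => [] [] [].
Qed.

(** Coordinate [i] contributes 0 on the left and 2 on the right; the other coordinates obey the
    triangle inequality. This is what stops geodesics from leaving a facet. *)
Lemma hdist_between i u v w :
  tnth u i = tnth w i -> tnth v i != tnth u i ->
  hdist u w < hdist u v + hdist v w.
Proof.
rewrite !hdistE -big_split (bigD1 i) //= [ltnRHS](bigD1 i) //= => <- vi.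
rewrite eqxx vi eq_sym vi add0n addSn ltnS leqW // leq_sum // => j _.
by case: (tnth u j) (tnth v j) (tnth w j) => [] [] [].
Qed.

Lemma hdist_eq0 u v : hdist u v = 0 -> u = v.
Proof.
move/eqP; rewrite cards_eq0 => /eqP/setP uv; apply: eq_from_tnth => i.
by have := uv i; rewrite !inE => /negbFE/eqP.
Qed.

Lemma hdist_flip i u v :
  tnth u i != tnth v i -> hdist u v = (hdist (flip i u) v).+1.
Proof.
move=> uvi; rewrite /hdist (cardsD1 i) inE uvi add1n; congr _.+1.
apply: eq_card => j; rewrite !inE tnth_mktuple.
by case: eqP => [->|//]; case: (tnth u i) (tnth v i) uvi => [] [].
Qed.

Lemma adj_flip i u : adj u (flip i u).
Proof.
apply/eqP; rewrite -[RHS](cards1 i); apply: eq_card => j.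
by rewrite !inE tnth_mktuple; case: (j == i); case: (tnth u j).
Qed.

Lemma walk_hdist x y p : walk adj x y p -> hdist x y <= size p.
Proof.
elim: p x => [|z p IHp] x [/= pth lst].
  by rewrite -lst hdistE big1 // => i _; rewrite eqxx.
case/andP: pth => xz pth; have zy := IHp z (conj pth lst).
(* By conversion, [adj x z] is the equation [hdist x z == 1]. *)
by rewrite (leq_trans (hdist_triangle z x y)) // -[X in X <= _]/(_ + _) {1}/hdist (eqP xz).
Qed.

(** Flip the differing coordinates one at a time. Together with [walk_hdist] this identifies [hdist]
    with the graph distance. *)
Lemma exists_walk x y : exists2 p, walk adj x y p & size p = hdist x y.
Proof.
move dE: (hdist x y) => d; elim: d x dE => [|d IHd] x dE.
  by exists [::] => //; split=> //; exact: hdist_eq0.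
have /card_gt0P[i] : 0 < hdist x y by rewrite dE.
rewrite inE => xyi; have := hdist_flip xyi; rewrite dE => -[/esym/IHd[p [pth lst] <-]].
by exists (flip i x :: p) => //; split; rewrite //= adj_flip.
Qed.

Lemma size_shortest_path x y p : shortest_path adj x y p -> size p = hdist x y.
Proof.
case=> pw min_p; apply/eqP; rewrite eqn_leq walk_hdist // andbT.
by have [q qw <-] := exists_walk x y; exact: min_p.
Qed.

(** Cut the geodesic at [z]: if [z] lay off the facet, the two pieces would together be longer than
    [hdist x y] by [hdist_between]. *)
Lemma convex_facet i b : convex adj [set u | tnth u i == b].
Proof.
move=> x y p; rewrite !inE => /eqP xi /eqP yi xyp z zp.
have := size_shortest_path xyp; case: xyp => -[pth lst] _.
case/splitPl: zp pth lst => p1 p2 lz.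
rewrite cat_path last_cat size_cat lz => /andP[pth1 pth2] lst sz.
apply/idPn; rewrite inE -xi => zi.
have := hdist_between (etrans xi (esym yi)) zi.
by rewrite -sz ltnNge leq_add // walk_hdist.
Qed.

(** Flipping a coordinate where [x] and [y] differ is the first step of some geodesic from [x] to
    [y]. *)
Lemma convex_flip K x y i : convex adj K -> x \in K -> y \in K ->
  tnth x i != tnth y i -> flip i x \in K.
Proof.
move=> cK xK yK xyi; have [p [pth lst] sz] := exists_walk (flip i x) y.
apply: (cK x y (flip i x :: p)) => //; last by rewrite !inE eqxx orbT.
split=> [|q /walk_hdist]; first by split; rewrite //= adj_flip.
by rewrite (hdist_flip xyi) /= sz.
Qed.

(** Move inside [K] from [w0] to any target [u]: where the current [w] differs from [u] at [i], some
    member of [K] agrees with [u] there, so [convex_flip] keeps [flip i w] in [K], one step closer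
    to [u]. *)
Lemma convex_meet_facets K : convex adj K -> K != set0 ->
  (forall i b, exists2 u, u \in K & tnth u i = b) -> K = setT.
Proof.
move=> cK /set0Pn[w0 w0K] meetK; apply/setP => u; rewrite inE.
move dE: (hdist w0 u) => d; elim: d w0 w0K dE => [|d IHd] w wK dE.
  by rewrite -(hdist_eq0 dE).
have /card_gt0P[i] : 0 < hdist w u by rewrite dE.
rewrite inE => wui; have [x xK xi] := meetK i (tnth u i).
apply: (IHd (flip i w)); first by apply: (convex_flip cK wK xK); rewrite xi.
by have := hdist_flip wui; rewrite dE => -[].
Qed.

Lemma cube_positionP (P : {set n.-tuple bool}) : 0 < n ->
  reflect (forall i b, exists2 u, u \notin P & tnth u i = b)
          (DNT_position adj P).
Proof.
move=> n_gt0; apply: (iffP eqP) => [hullT i b | meetP].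
  apply: contrapT => no_u.
  (* If [P] contains a facet, the unplayed vertices lie in the opposite one, which is convex and
     misses the constant string [b]. *)
  have subF : ~: P \subset [set u | tnth u i == ~~ b].
    apply/subsetP => u; rewrite !inE => uP; apply: contraPT no_u => ui.
    by apply; exists u => //; case: (b) (tnth u i) ui => [] [].
  have /subsetP/(_ [tuple b | _ < n]) := hull_min (@convex_facet i (~~ b)) subF.
  by rewrite hullT !inE tnth_mktuple => /(_ isT); case: (b).
have PS : ~: P \subset hull adj (~: P) by exact: sub_hull.
have meet i b : exists2 u, u \in hull adj (~: P) & tnth u i = b.
  by have [u uP ui] := meetP i b; exists u; rewrite // (subsetP PS) // inE.
apply: convex_meet_facets => //; first exact: convex_hull.
by have [u uH _] := meet (Ordinal n_gt0) true; apply/set0Pn; exists u.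
Qed.

Lemma antipodeK : involutive antipode.
Proof. by move=> u; apply: eq_from_tnth => i; rewrite !tnth_map negbK. Qed.

Lemma antipode_neq u : 0 < n -> antipode u != u.
Proof.
move=> n_gt0; apply/eqP => /(congr1 (fun w => tnth w (Ordinal n_gt0))).
by rewrite tnth_map; case: (tnth _ _).
Qed.

Lemma antipode_position (P : {set n.-tuple bool}) v : 0 < n ->
  antipode @^-1: P = P -> DNT_position adj (v |: P) ->
  DNT_position adj (antipode v |: (v |: P)).
Proof.
move=> n_gt0 aP /cube_positionP-/(_ n_gt0) pos_v.
apply/cube_positionP => // i b; have [u uP ui] := pos_v i b.
have [uv | u_neq] := eqVneq u (antipode v); last first.
  by exists u; rewrite // in_setU1 negb_or u_neq.
(* The reply has taken the witness [u] itself, so reflect a witness [w] from the opposite facet. Its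
   antipode avoids [P] by symmetry and avoids [antipode v] since [w] is not [v]; were it [v], then
   [w] would be [u], which differs from [w] at [i]. *)
have [w wP wi] := pos_v i (~~ b).
exists (antipode w); last by rewrite tnth_map wi negbK.
move: wP; rewrite !in_setU1 !negb_or (inj_eq (inv_inj antipodeK)) => /andP[-> wP].
rewrite (inv_eq antipodeK) -uv -[in _ \in P]aP inE antipodeK wP andbT /=.
by apply/eqP => wu; move: wi; rewrite wu ui; case: (b).
Qed.

End Cube.

Theorem proposition5p6 (n : nat) (hn : 3 <= n) : nim_DNT (@cube_adj n) = 0.
Proof.
have n_gt0 : 0 < n by apply: leq_trans hn.
apply: (pairing_strategy (@antipodeK n)) => [v | P v |].
- exact: antipode_neq.
- exact: antipode_position.
- exact: preimset0.
Qed.
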